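(* Let $\beta>1$ and let $\mathcal{D}_\beta$ be the distribution on $[0,\infty)$ with density $f_\beta(z) = C_\beta e^{-z^\beta}$ for $z\ge 0$ (and $0$ for $z<0$), where $C_\beta$ is the normalizing constant. Then for every $\epsilon>0$, GBPA with the stochastically smoothed potential whose perturbation is $\eta Z$, $Z\sim\mathcal{D}_\beta$, with an appropriate choice of scale $\eta>0$ (depending on $N$ and $T$), has expected regret $O\big((TN)^{1/2+\epsilon}\big)$ uniformly over gain sequences $g_1,\dots,g_T\in[-1,0]^N$.
   Context: Adversarial multi-armed bandit: $N$ arms, $T$ rounds; an oblivious adversary fixes $g_1,\dots,g_T \in [-1,0]^N$ in advance. For a random variable $W$ with a continuous distribution and finite expectation, the stochastically smoothed potential is $\tilde\Phi(G) = \mathbb{E}[\max_{i}(G_i + W_i)]$, $W_1,\dots,W_N$ i.i.d. copies of $W$; $\nabla_i\tilde\Phi(G) = \mathbb{P}(i = \arg\max_j (G_j+W_j))$. ''Perturbation $\eta Z$'' means $W=\eta Z$. GBPA$(\tilde\Phi)$: $\hat G_0 = 0$; for $t=1,\dots,T$: $p_t = \nabla\tilde\Phi(\hat G_{t-1})$, draw $i_t \sim p_t$, observe only $g_{t,i_t}$, set $\hat g_t = \frac{g_{t,i_t}}{p_{t,i_t}} e_{i_t}$, $\hat G_t = \hat G_{t-1} + \hat g_t$. Expected regret: $\mathbb{E}\big[\max_{i}\sum_{t=1}^T (g_{t,i} - g_{t,i_t})\big]$ over the learner's randomness. Constants in $O(\cdot)$ depend on $\beta,\epsilon$ only. *)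

(* Defs.v *)
From HB Require Import structures.
From mathcomp Require Import all_boot all_order all_algebra.
From mathcomp Require Import all_classical all_reals all_analysis.
Set Implicit Arguments. Unset Strict Implicit. Unset Printing Implicit Defensive.
Import Order.TTheory GRing.Theory Num.Theory.
Import numFieldNormedType.Exports.
Local Open Scope classical_set_scope.
Local Open Scope ring_scope.

Section Bandit.
Variable R : realType.

Local Notation mu := (@lebesgue_measure R).

Definition Cbeta (beta : R) : R :=
  (Rintegral mu [set z : R | 0 <= z] (fun z => expR (- (z `^ beta))))^-1.

Definition fbeta (beta : R) (z : R) : R :=
  if 0 <= z then Cbeta beta * expR (- (z `^ beta)) else 0.

(* Density of W = eta * Z when Z has density f *)
Definition scaled_density (f : R -> R) (eta : R) (w : R) : R :=
  f (w / eta) / eta.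

Definition cdf (f : R -> R) (x : R) : R :=
  Rintegral mu [set w : R | w <= x] f.

(* grad_i tilde Phi(G) = P(i = argmax_j (G_j + W_j)) for W_1..W_N i.i.d.
   with density f, written via independence:
   = \int f(w) \prod_{j <> i} P(W_j < G_i - G_j + w) dw. *)
Definition smoothed_grad (N : nat) (f : R -> R) (G : 'I_N -> R) (i : 'I_N) : R :=
  Rintegral mu setT
    (fun w => f w * \prod_(j < N | j != i) cdf f (G i - G j + w)).

(* Estimated cumulative gain hat G_t along a trajectory s of played arms
   (rounds indexed 0..T-1), for gains g and sampling rule p. *)
Fixpoint Ghat (N T : nat) (p : ('I_N -> R) -> 'I_N -> R)
    (g : 'I_T -> 'I_N -> R) (s : {ffun 'I_T -> 'I_N}) (t : nat) : 'I_N -> R :=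
  match t with
  | 0 => fun _ => 0
  | t'.+1 => fun i =>
      Ghat p g s t' i +
      match @insub nat (fun k => k < T)%N 'I_T t' with
      | Some u => if s u == i then g u i / p (Ghat p g s t') i else 0
      | None => 0
      end
  end.

Definition traj_prob (N T : nat) (p : ('I_N -> R) -> 'I_N -> R)
    (g : 'I_T -> 'I_N -> R) (s : {ffun 'I_T -> 'I_N}) : R :=
  \prod_(u : 'I_T) p (Ghat p g s u) (s u).

Definition maxlist (l : seq R) : R := foldr Num.max (head 0 l) l.

Definition traj_regret (N T : nat) (g : 'I_T -> 'I_N -> R)
    (s : {ffun 'I_T -> 'I_N}) : R :=
  maxlist [seq \sum_(u : 'I_T) (g u i - g u (s u)) | i <- enum 'I_N].

Definition expected_regret (N T : nat) (p : ('I_N -> R) -> 'I_N -> R)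
    (g : 'I_T -> 'I_N -> R) : R :=
  \sum_(s : {ffun 'I_T -> 'I_N}) traj_prob p g s * traj_regret g s.

Definition gbpa_regret_beta (beta eta : R) (N T : nat)
    (g : 'I_T -> 'I_N -> R) : R :=
  expected_regret (@smoothed_grad N (scaled_density (fbeta beta) eta)) g.

End Bandit.

(* Main.v *)
(** The regret is controlled through the potential [Phi(G) = E max_j (G_j + W_j)], written as
    the one-dimensional integral of [1_{x >= 0} - prod_j F(x - G_j)] with [F] the distribution
    function of [W]; it dominates every [G_i].  If arm [i] of probability [p] is played and its
    estimate drops by [z <= 1/p], the Bregman term [Phi(G - z e_i) - Phi(G) + z p] is the integral
    of [(z f(u) - (F(u + z) - F(u))) * H], where [H] is the product of the other distribution
    functions.  The integrand is nonpositive for [u < 0], and since [f] is nonincreasing on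
    [[0, +oo[] it is at most [z (f(u) - f(u + z)) <= z^2 f(u) beta (1 + u/eta)^(beta - 1) / eta]
    otherwise.  Cutting [(1 + u/eta)^(beta - 1)] at level [(TN)^eps] costs only an exponentially
    decaying remainder of mass [delta = O((TN)^-1)], so the expected Bregman term of one arm is at
    most [beta (TN)^eps / eta + min(p, delta / p)].  With [eta = (TN)^(1/2)] the [T] rounds and
    [N] arms contribute [O((TN)^(1/2 + eps))], while [Phi(0) = O(eta N^eps)]. *)
Require Import Defs.
From HB Require Import structures.
From mathcomp Require Import all_boot all_order all_algebra.
From mathcomp Require Import all_classical all_reals all_analysis.
From mathcomp Require Import measurable_realfun.
From mathcomp Require Import ring lra.
Import Order.TTheory GRing.Theory Num.Theory.
Set Implicit Arguments.
Unset Strict Implicit.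
Unset Printing Implicit Defensive.
Local Open Scope classical_set_scope.
Local Open Scope ring_scope.

(** * Trajectories, and regret bounded by a one-round potential inequality *)

Lemma maxlist_le (R : realType) (l : seq R) (M : R) :
  l != [::] -> (forall x, x \in l -> x <= M) -> maxlist l <= M.
Proof.
case: l => [//|a l] _ H; rewrite /maxlist.
(* The fold starts from the head, which is itself an entry of a nonempty list; the induction then
   frees this starting value. *)
have Ha : head 0 (a :: l) <= M by apply: H; rewrite inE eqxx.
elim: (a :: l) (head 0 (a :: l)) Ha H => [//|b l' IH] h Hh H /=.
rewrite ge_max H ?inE ?eqxx//=; apply: IH => // x xl.
by apply: H; rewrite inE xl orbT.
Qed.

Section Trajectory.
Variables (R : realType) (N : nat).
Implicit Types (p : ('I_N -> R) -> 'I_N -> R) (T : nat).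

Definition estimator_step p (h : 'I_N -> R) (G : 'I_N -> R) (a : 'I_N) : 'I_N -> R :=
  fun i => G i + (if a == i then h i / p G i else 0).

(** Trajectories grow at the end because each estimate depends only on earlier plays; induction on
    [T] then conditions on all rounds but the last. *)
Definition ffun_rcons T (s : {ffun 'I_T -> 'I_N}) (a : 'I_N) : {ffun 'I_T.+1 -> 'I_N} :=
  [ffun u => if unlift ord_max u is Some v then s v else a].

Definition ffun_belast T (s : {ffun 'I_T.+1 -> 'I_N}) : {ffun 'I_T -> 'I_N} :=
  [ffun v => s (lift ord_max v)].

Definition gain_belast T (g : 'I_T.+1 -> 'I_N -> R) : 'I_T -> 'I_N -> R :=
  fun v => g (lift ord_max v).

Lemma ffun_rcons_lift T s a v : @ffun_rcons T s a (lift ord_max v) = s v.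
Proof. by rewrite ffunE liftK. Qed.

Lemma ffun_rcons_max T s a : @ffun_rcons T s a ord_max = a.
Proof. by rewrite ffunE unlift_none. Qed.

Lemma sum_ffun_rcons T (E : {ffun 'I_T.+1 -> 'I_N} -> R) :
  \sum_s E s = \sum_(s : {ffun 'I_T -> 'I_N}) \sum_a E (ffun_rcons s a).
Proof.
rewrite pair_big /=.
rewrite (reindex (fun q : {ffun 'I_T -> 'I_N} * 'I_N => ffun_rcons q.1 q.2)) //=.
exists (fun s => (ffun_belast s, s ord_max)) => [[s a] _|s _] /=.
  congr (_, _); last exact: ffun_rcons_max.
  by apply/ffunP => v; rewrite ffunE ffun_rcons_lift.
apply/ffunP => u; rewrite ffunE; case: unliftP => [v ->|->] //.
by rewrite ffunE.
Qed.

Lemma Ghat_rcons T p (g : 'I_T.+1 -> 'I_N -> R) s a t : (t <= T)%N ->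
  Ghat p g (ffun_rcons s a) t = Ghat p (gain_belast g) s t.
Proof.
elim: t => [//|t IH] tT /=; have {}IH := IH (ltnW tT).
apply/funext => i; rewrite IH.
have -> : @insub nat (fun k => k < T.+1)%N 'I_T.+1 t = Some (lift ord_max (Ordinal tT)).
  have tT1 : (t < T.+1)%N by exact: ltnW.
  by rewrite insubT; congr Some; apply/val_inj; rewrite /= /bump leqNgt tT.
have -> : @insub nat (fun k => k < T)%N 'I_T t = Some (Ordinal tT).
  by rewrite insubT; congr Some; apply/val_inj.
by rewrite ffun_rcons_lift.
Qed.

Lemma Ghat_rcons_last T p (g : 'I_T.+1 -> 'I_N -> R) s a :
  Ghat p g (ffun_rcons s a) T.+1
  = estimator_step p (g ord_max) (Ghat p (gain_belast g) s T) a.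
Proof.
apply/funext => i /=; rewrite Ghat_rcons//.
have -> : @insub nat (fun k => k < T.+1)%N 'I_T.+1 T = Some ord_max.
  by rewrite (insubT (fun k => k < T.+1)%N (ltnSn T)); congr Some; apply/val_inj.
by rewrite ffun_rcons_max.
Qed.

Lemma traj_prob_rcons T p (g : 'I_T.+1 -> 'I_N -> R) s a :
  traj_prob p g (ffun_rcons s a)
  = traj_prob p (gain_belast g) s * p (Ghat p (gain_belast g) s T) a.
Proof.
rewrite /traj_prob big_ord_recr /=; congr (_ * _); last first.
  by rewrite ffun_rcons_max Ghat_rcons.
apply: eq_bigr => v _.
have -> : widen_ord (leqnSn T) v = lift ord_max v.
  by apply/val_inj; rewrite /= /bump leqNgt ltn_ord.
by rewrite ffun_rcons_lift Ghat_rcons// ltnW.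
Qed.

Lemma sum_gain_rcons T (g : 'I_T.+1 -> 'I_N -> R) s a :
  \sum_u g u (ffun_rcons s a u) = \sum_u gain_belast g u (s u) + g ord_max a.
Proof.
rewrite big_ord_recr /= ffun_rcons_max; congr (_ + _); apply: eq_bigr => v _.
have -> : widen_ord (leqnSn T) v = lift ord_max v.
  by apply/val_inj; rewrite /= /bump leqNgt ltn_ord.
by rewrite ffun_rcons_lift.
Qed.

Variables (p : ('I_N -> R) -> 'I_N -> R).
Hypothesis p_gt0 : forall G i, 0 < p G i.
Hypothesis p_sum1 : forall G, \sum_i p G i = 1.

Lemma traj_prob_ge0 T (g : 'I_T -> 'I_N -> R) s : 0 <= traj_prob p g s.
Proof. by apply: prodr_ge0 => u _; exact: ltW. Qed.

Lemma sum_traj_prob T (g : 'I_T -> 'I_N -> R) : \sum_s traj_prob p g s = 1.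
Proof.
elim: T g => [|T IH] g.
  rewrite (big_pred1 [ffun i : 'I_0 => match i with Ordinal _ h => False_rect _ (notF h) end]).
    by rewrite /traj_prob big_ord0.
  by move=> s /=; apply/esym/eqP/ffunP => -[].
rewrite sum_ffun_rcons -(IH (gain_belast g)); apply: eq_bigr => s _.
under eq_bigr do rewrite traj_prob_rcons.
by rewrite -mulr_sumr p_sum1 mulr1.
Qed.

Lemma Ghat_le0 T (g : 'I_T -> 'I_N -> R) s t i :
  (forall u j, g u j <= 0) -> Ghat p g s t i <= 0.
Proof.
move=> g0; elim: t i => [//|t IH] i /=.
rewrite -[leRHS]addr0 lerD//; case: insub => [u|//]; case: ifP => // _.
by rewrite pmulr_lle0 ?invr_gt0.
Qed.

(** Unbiasedness of importance weighting: arm [i] is hit with probability [p G i], which cancels the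
    division in its estimate because it is positive. *)
Lemma sum_traj_prob_Ghat T (g : 'I_T -> 'I_N -> R) i :
  \sum_s traj_prob p g s * Ghat p g s T i = \sum_u g u i.
Proof.
elim: T g => [|T IH] g.
  by rewrite big_ord0 big1// => s _; rewrite mulr0.
rewrite sum_ffun_rcons.
transitivity (\sum_(s : {ffun 'I_T -> 'I_N}) traj_prob p (gain_belast g) s *
    (Ghat p (gain_belast g) s T i + g ord_max i)).
  apply: eq_bigr => s _.
  under eq_bigr do rewrite traj_prob_rcons Ghat_rcons_last -mulrA.
  rewrite -mulr_sumr; congr (_ * _).
  set G := Ghat _ _ s T.
  under eq_bigr do rewrite /estimator_step mulrDr.
  rewrite big_split /= -mulr_suml p_sum1 mul1r; congr (_ + _).
  rewrite (bigD1 i)//= eqxx mulrCA mulfV ?mulr1 ?gt_eqF//.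
  by rewrite big1 ?addr0// => a /negbTE ->; rewrite mulr0.
under eq_bigr do rewrite mulrDr.
rewrite big_split /= -mulr_suml sum_traj_prob mul1r IH big_ord_recr /=.
congr (_ + _); apply: eq_bigr => v _; rewrite /gain_belast; congr (g _ _).
by apply/val_inj; rewrite /= /bump leqNgt ltn_ord.
Qed.

(** [B] bounds the expected excess of the potential change over the learner's gain in one round.
    Only [G <= 0] has to be covered, since nonpositive gains keep all estimates nonpositive. *)
Variables (Phi : ('I_N -> R) -> R) (B : R).
Hypothesis Phi_step : forall (G h : 'I_N -> R), (forall i, G i <= 0) ->
  (forall i, -1 <= h i <= 0) ->
  \sum_a p G a * Phi (estimator_step p h G a)
    <= Phi G + \sum_a p G a * h a + B.

(** The one-round inequality telescopes: averaging over the last arm, with the earlier plays fixed,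
    costs one [B]. *)
Lemma potential_growth T (g : 'I_T -> 'I_N -> R) :
  (forall t i, -1 <= g t i <= 0) ->
  \sum_s traj_prob p g s * (Phi (Ghat p g s T) - \sum_u g u (s u))
    <= Phi (fun=> 0) + T%:R * B.
Proof.
elim: T g => [|T IH] g g01.
  rewrite mul0r addr0 -[leRHS]mul1r -(sum_traj_prob g) mulr_suml.
  by apply: ler_sum => s _; rewrite big_ord0 subr0.
rewrite sum_ffun_rcons.
apply: (@le_trans _ _ (\sum_(s : {ffun 'I_T -> 'I_N}) traj_prob p (gain_belast g) s *
    (Phi (Ghat p (gain_belast g) s T) - \sum_u gain_belast g u (s u) + B))).
  apply: ler_sum => s _.
  under eq_bigr do rewrite traj_prob_rcons Ghat_rcons_last sum_gain_rcons -mulrA.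
  rewrite -mulr_sumr; apply: ler_wpM2l; first exact: traj_prob_ge0.
  set G := Ghat _ _ s T; set S := \sum_u gain_belast g u (s u).
  have G0 i : G i <= 0 by apply: Ghat_le0 => u j; case/andP: (g01 (lift ord_max u) j).
  have := Phi_step G0 (g01 ord_max).
  under [X in _ -> X <= _]eq_bigr do rewrite mulrBr mulrDr.
  rewrite sumrB big_split /= -mulr_suml p_sum1 mul1r; lra.
under eq_bigr do rewrite mulrDr.
rewrite big_split /= -mulr_suml sum_traj_prob mul1r.
rewrite -natr1 mulrDl mul1r addrA lerD2r; apply: IH => t i; exact: g01.
Qed.

Hypothesis Phi_ge : forall (G : 'I_N -> R) i, (forall j, G j <= 0) -> G i <= Phi G.

(** The adversary is oblivious, so the best arm in hindsight is the same on all trajectories. Its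
    total gain is the mean of its estimate, and the potential dominates that estimate. *)
Lemma expected_regret_le T (g : 'I_T -> 'I_N -> R) :
  (0 < N)%N -> (forall t i, -1 <= g t i <= 0) ->
  expected_regret p g <= Phi (fun=> 0) + T%:R * B.
Proof.
move=> N0 g01; apply: le_trans (potential_growth g01).
have [i _ /= imax] : exists2 i : 'I_N, true & forall j, \sum_u g u j <= \sum_u g u i.
  case: (@arg_maxP _ R 'I_N (Ordinal N0) xpredT (fun i => \sum_u g u i)) => // i _ H.
  by exists i => // j; apply: H.
apply: (@le_trans _ _ (\sum_s traj_prob p g s * (Ghat p g s T i - \sum_u g u (s u)))).
  under [leRHS]eq_bigr do rewrite mulrBr.
  rewrite sumrB sum_traj_prob_Ghat -[X in X - _]mul1r -(sum_traj_prob g) mulr_suml -sumrB.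
  apply: ler_sum => s _; rewrite -mulrBr; apply: ler_wpM2l; first exact: traj_prob_ge0.
  apply: maxlist_le => [|x /mapP[j _ ->]].
    by rewrite -size_eq0 size_map size_enum_ord -lt0n.
  by rewrite sumrB lerB.
apply: ler_sum => s _; apply: ler_wpM2l; first exact: traj_prob_ge0.
rewrite lerB//; apply: Phi_ge => j; apply: Ghat_le0 => u k; by case/andP: (g01 u k).
Qed.

End Trajectory.

(** * Integration on the real line: affine substitution and the product rule *)

Section Measure.
Variable R : realType.
Local Notation mu := (@lebesgue_measure R).
Implicit Types (f g F : R -> R) (a b x y z : R).

(** The image of Lebesgue measure under [x |-> a * x + b], scaled by [a], gives half-open intervals
    their length, so it is Lebesgue measure by uniqueness. *)
Lemma ge0_integral_affine (a b : R) (f : R -> \bar R) : 0 < a ->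
  measurable_fun setT f -> (forall x, (0 <= f x)%E) ->
  (\int[mu]_x f x = a%:E * \int[mu]_x f (a * x + b)%R)%E.
Proof.
move=> a0 mf f0.
have mphi : measurable_fun setT (fun x : R => a * x + b : measurableTypeR R).
  by apply: measurable_funD => //; apply: measurable_funM.
pose k : {nonneg R} := NngNum (ltW a0).
pose nu0 : {measure set (measurableTypeR R) -> \bar R} :=
  mscale k (pushforward mu (fun x : R => a * x + b : measurableTypeR R)).
pose nu := nu0 mphi.
have munu A : measurable A -> mu A = nu A.
  apply: lebesgue_measure_unique => _ [[c d] _ <-].
  rewrite /nu /nu0 /= /mscale /= /pushforward.
  have -> : (fun x : R => a * x + b) @^-1` `]c, d] = `](c - b) / a, (d - b) / a]%classic.
    apply/seteqP; split => x /=; rewrite !in_itv /=.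
      by rewrite ltr_pdivrMr// ler_pdivlMr// ltrBlDr lerBrDr mulrC.
    by rewrite ltr_pdivrMr// ler_pdivlMr// ltrBlDr lerBrDr mulrC.
  rewrite !lebesgue_measure_itv /= !lte_fin ltr_pM2r ?invr_gt0// ltrD2r.
  case: ifP => cd; last by rewrite mule0.
  rewrite -!EFinD -EFinM; congr (_%:E); field; exact: lt0r_neq0.
rewrite (_ : (\int[mu]_x f x = \int[nu]_x f x)%E); last first.
  by apply: eq_measure_integral => A mA _; exact: munu.
rewrite /nu /nu0 ge0_integral_mscale//=; congr (_ * _)%E.
by rewrite ge0_integral_pushforward.
Qed.

Lemma Rintegral_translation (b : R) f :
  measurable_fun setT f -> (forall x, 0 <= f x) ->
  Rintegral mu setT f = Rintegral mu setT (fun x => f (x + b)).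
Proof.
move=> mf f0; rewrite /Rintegral (@ge0_integral_affine 1 b)//.
- rewrite mul1e; congr fine; apply: eq_integral => x _; by rewrite mul1r.
- exact/measurable_EFinP.
Qed.

Lemma set_le_itv x : [set w : R | w <= x] = `]-oo, x]%classic.
Proof. by apply/seteqP; split => w /=; rewrite in_itv. Qed.

(* Fubini's theorem over the triangle [t <= s] in [D * D]. *)
Lemma integral_product_rule (D : set R) f1 f2 F1 F2 (a1 a2 : R) :
  measurable D -> (forall s t, D s -> t <= s -> D t) ->
  measurable_fun setT f1 -> measurable_fun setT f2 ->
  measurable_fun setT F1 -> measurable_fun setT F2 ->
  (forall x, 0 <= f1 x) -> (forall x, 0 <= f2 x) ->
  (forall x, \int[mu]_(w in `]-oo, x]) (f1 w)%:E = (F1 x)%:E)%E ->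
  (forall x, \int[mu]_(w in `]-oo, x]) (f2 w)%:E = (F2 x)%:E)%E ->
  (\int[mu]_(w in D) (f1 w)%:E = a1%:E)%E ->
  (\int[mu]_(w in D) (f2 w)%:E = a2%:E)%E ->
  (\int[mu]_(w in D) (f1 w * F2 w + F1 w * f2 w)%:E = (a1 * a2)%:E)%E.
Proof.
move=> mD dD mf1 mf2 mF1 mF2 f10 f20 HF1 HF2 Ha1 Ha2.
have F10 x : 0 <= F1 x.
  by rewrite -lee_fin -HF1; apply: integral_ge0 => w _; rewrite lee_fin.
have F20 x : 0 <= F2 x.
  by rewrite -lee_fin -HF2; apply: integral_ge0 => w _; rewrite lee_fin.
pose h (q : R * R) : R := (\1_D q.1 * f1 q.1) * (f2 q.2 * (q.2 <= q.1)%R%:R).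
have mh : measurable_fun setT (EFin \o h).
  apply/measurable_EFinP; apply: measurable_funM.
    apply: measurable_funM.
      by apply: measurableT_comp; [exact: measurable_indic|exact: measurable_fst].
    by apply: measurableT_comp; [exact: mf1|exact: measurable_fst].
  apply: measurable_funM.
    by apply: measurableT_comp; [exact: mf2|exact: measurable_snd].
  have -> : (fun q : R * R => (q.2 <= q.1)%R%:R : R) = \1_[set q : R * R | q.2 <= q.1].
    by apply/funext => q; rewrite indicE mem_setE.
  apply: measurable_indic.
  rewrite (_ : [set q : R * R | q.2 <= q.1] = setT `&` (fun q : R * R => q.2 <= q.1) @^-1` [set true]).
    exact: measurable_fun_ler.
  by rewrite setTI; apply/seteqP; split => q.
have h0 q : (0 <= (EFin \o h) q)%E.
  by rewrite lee_fin /h !mulr_ge0.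
have E1 : (\int[mu]_(w in D) (f1 w * F2 w)%:E = \int[mu]_s \int[mu]_t (h (s, t))%:E)%E.
  rewrite integral_mkcond; apply: eq_integral => s _; rewrite /h/= patchE indicE.
  case: ifPn => sD; last first.
    by rewrite mul0r integral0_eq// => t _; rewrite mul0r.
  rewrite mul1r EFinM -HF2 -ge0_integralZl//=; last 3 first.
  - exact/measurable_EFinP/measurable_funTS.
  - by move=> t _; rewrite lee_fin.
  - by rewrite lee_fin.
  rewrite integral_mkcond; apply: eq_integral => t _; rewrite patchE.
  by rewrite mem_setE in_itv /=; case: ifP => _; rewrite ?mulr1// !mulr0.
rewrite (_ : (\int[mu]_(w in D) (f1 w * F2 w + F1 w * f2 w)%:E)%E =
  (\int[mu]_(w in D) (f1 w * F2 w)%:E + \int[mu]_(w in D) (F1 w * f2 w)%:E)%E); last first.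
  rewrite -ge0_integralD//.
  - by move=> w _; rewrite lee_fin mulr_ge0.
  - by apply/measurable_EFinP/measurable_funTS/measurable_funM.
  - by move=> w _; rewrite lee_fin mulr_ge0.
  - by apply/measurable_EFinP/measurable_funTS/measurable_funM.
(* After the swap, for fixed [t] in [D] the first summand carries the mass of [f1] on [s >= t] and
   the second its mass on [s < t], both times [f2 t]; together they give [a1 * f2 t]. *)
rewrite E1 (@fubini_tonelli _ _ _ _ _ mu mu (EFin \o h))//.
rewrite [X in (_ + X)%E]integral_mkcond -ge0_integralD//=; last 4 first.
- by move=> t _; apply: integral_ge0 => s _; exact: h0.
- exact: (@measurable_fun_fubini_tonelli_G _ _ _ _ _ mu (EFin \o h)).
- by move=> t _; rewrite patchE; case: ifP => // _; rewrite lee_fin mulr_ge0.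
- apply/(measurable_restrictT _ mD).
  by apply/measurable_EFinP/measurable_funTS/measurable_funM.
transitivity (\int[mu]_(t in D) (a1%:E * (f2 t)%:E))%E; last first.
  rewrite ge0_integralZl//=; last 3 first.
  - exact/measurable_EFinP/measurable_funTS.
  - by move=> t _; rewrite lee_fin.
  - by rewrite -Ha1; apply: integral_ge0 => w _; rewrite lee_fin.
  by rewrite Ha2 EFinM.
rewrite [RHS]integral_mkcond; apply: eq_integral => t _; rewrite !patchE.
case: ifPn => tD; last first.
  rewrite adde0 integral0_eq// => s _; rewrite /h/= indicE.
  case: (boolP (s \in D)) => [sD|]; last by rewrite !mul0r.
  case: (leP t s) => [ts|]; last by rewrite !mulr0.
  by move: tD; rewrite notin_setE => -[]; apply: (dD s) => //; exact: set_mem.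
have -> : (\int[mu]_s (h (s, t))%:E = (f2 t)%:E * \int[mu]_(s in D `&` `[t, +oo[) (f1 s)%:E)%E.
  rewrite -ge0_integralZl//=; last 4 first.
  - exact: measurableI.
  - exact/measurable_EFinP/measurable_funTS.
  - by move=> s _; rewrite lee_fin.
  - by rewrite lee_fin.
  rewrite [RHS]integral_mkcond; apply: eq_integral => s _; rewrite patchE /h/= in_setI indicE.
  rewrite mem_setE in_itv/= andbT.
  case: (s \in D) => /=; last by rewrite !mul0r.
  by case: (t <= s); rewrite /= ?mulr0// mulr1 mul1r mulrC.
(* Dropping the endpoint [t], a null set, makes the two ranges of integration disjoint. *)
rewrite EFinM -HF1 [X in (_ + X)%E]muleC -integral_itv_bndo_bndc; last first.
  exact/measurable_EFinP/measurable_funTS.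
rewrite -ge0_muleDr; last 2 first.
- by apply: integral_ge0 => w _; rewrite lee_fin.
- by apply: integral_ge0 => w _; rewrite lee_fin.
rewrite -ge0_integral_setU//=.
- rewrite (_ : D `&` `[t, +oo[ `|` `]-oo, t[ = D) ?Ha1 1?muleC//.
  apply/seteqP; split => w /=; rewrite !in_itv /= ?andbT.
    by move=> [[]//|wt]; apply: (dD t); [exact: set_mem|exact: ltW].
  by move=> wD; case: (leP t w) => wt; [left|right].
- exact: measurableI.
- exact/measurable_EFinP/measurable_funTS.
- by move=> w _; rewrite lee_fin.
- apply/disj_setPS => w /= [[_]]; rewrite !in_itv /= andbT => tw wt.
  by have := lt_le_trans wt tw; rewrite ltxx.
Qed.

End Measure.

(** * Distribution functions and densities of maxima of independent variables *)

Section Cdf.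
Variable R : realType.
Local Notation mu := (@lebesgue_measure R).
Implicit Types (f g F : R -> R) (a b x y z : R).

Lemma ge0_integrableT f : measurable_fun setT f -> (forall x, 0 <= f x) ->
  (\int[mu]_x (f x)%:E < +oo)%E -> mu.-integrable setT (EFin \o f).
Proof.
move=> mf f0 fy; apply/integrableP; split; first exact/measurable_EFinP.
by under eq_integral do rewrite /= ger0_norm//.
Qed.

Lemma le_integrableT f g : measurable_fun setT f -> (forall x, `|f x| <= g x) ->
  mu.-integrable setT (EFin \o g) -> mu.-integrable setT (EFin \o f).
Proof.
move=> mf fg; apply: (@le_integrable _ _ _ mu setT measurableT).
  exact/measurable_EFinP.
by move=> x _; rewrite /= lee_fin (le_trans (fg x))// ler_norm.
Qed.

Lemma integrableZT (k : R) f : mu.-integrable setT (EFin \o f) ->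
  mu.-integrable setT (EFin \o (fun x => k * f x)).
Proof. by move=> fi; exact: (integrableZl measurableT k fi). Qed.

Lemma integrableDT f g : mu.-integrable setT (EFin \o f) ->
  mu.-integrable setT (EFin \o g) ->
  mu.-integrable setT (EFin \o (fun x => f x + g x)).
Proof. by move=> fi gi; exact: (integrableD measurableT fi gi). Qed.

Lemma integrableBT f g : mu.-integrable setT (EFin \o f) ->
  mu.-integrable setT (EFin \o g) ->
  mu.-integrable setT (EFin \o (fun x => f x - g x)).
Proof. by move=> fi gi; exact: (integrableB measurableT fi gi). Qed.

Lemma Rintegral_indic_itv a b : a <= b ->
  Rintegral mu setT (\1_(`[a, b]%classic : set R)) = b - a.
Proof.
move=> ab; rewrite /Rintegral integral_indic//= setIT lebesgue_measure_itv /= lte_fin.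
case: ltP => [_|ba]; first by rewrite -EFinB.
by rewrite (le_anti (introT andP (conj ab ba))) subrr.
Qed.

Definition is_cdf F f := [/\ measurable_fun setT f, measurable_fun setT F,
  forall x, 0 <= f x,
  forall x, (\int[mu]_(w in `]-oo, x]) (f w)%:E = (F x)%:E)%E &
  (\int[mu]_w (f w)%:E = 1)%E].

(** The product is the distribution function of the maximum of two independent variables. The
    product rule on a half-line gives its values, and on the whole line the total mass one. *)
Lemma is_cdfM F1 f1 F2 f2 : is_cdf F1 f1 -> is_cdf F2 f2 ->
  is_cdf (fun x => F1 x * F2 x) (fun x => f1 x * F2 x + F1 x * f2 x).
Proof.
move=> [mf1 mF1 f10 HF1 t1] [mf2 mF2 f20 HF2 t2].
have F10 x : 0 <= F1 x.
  by rewrite -lee_fin -HF1; apply: integral_ge0 => w _; rewrite lee_fin.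
have F20 x : 0 <= F2 x.
  by rewrite -lee_fin -HF2; apply: integral_ge0 => w _; rewrite lee_fin.
split.
- by apply: measurable_funD; apply: measurable_funM.
- exact: measurable_funM.
- by move=> x; rewrite addr_ge0// mulr_ge0.
- move=> x; apply: integral_product_rule => //.
  by move=> s t /=; rewrite !in_itv /= => sx ts; exact: le_trans sx.
- by rewrite (@integral_product_rule _ setT f1 f2 F1 F2 1 1)// mulr1.
Qed.

Section Product.
Variables (I : eqType) (Fs fs : I -> R -> R).

(** Leibniz rule for the derivative of the product of the [Fs], unfolded one factor at a time to
    match [is_cdfM]. The empty product is constant, hence the value 0, and it is no distribution
    function, hence the nonempty list in [is_cdf_prod]. *)
Fixpoint prod_density (s : seq I) (x : R) : R :=
  if s is j :: s' then
    fs j x * \prod_(k <- s') Fs k x + Fs j x * prod_density s' x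
  else 0.

Lemma prod_densityE s x : uniq s ->
  prod_density s x = \sum_(i <- s) fs i x * \prod_(j <- s | j != i) Fs j x.
Proof.
elim: s => [|j s IH] /=; first by rewrite big_nil.
move=> /andP[js us]; rewrite big_cons big_cons eqxx /= IH//; congr (_ + _).
  congr (_ * _); rewrite [RHS]big_seq_cond [LHS]big_seq_cond.
  apply: eq_bigl => k; rewrite andbT; case: (boolP (k \in s)) => //= ks.
  by apply/esym; apply: contraNneq js => <-.
rewrite mulr_sumr [LHS]big_seq_cond [RHS]big_seq_cond; apply: eq_bigr => i.
rewrite andbT => iS; rewrite big_cons ifT; first by rewrite mulrCA.
by apply: contraNneq js => ->.
Qed.

Lemma is_cdf_prod i s : (forall j, is_cdf (Fs j) (fs j)) ->
  is_cdf (fun x => \prod_(j <- i :: s) Fs j x) (prod_density (i :: s)).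
Proof.
move=> H; elim: s i => [|j s IH] i.
  have -> : (fun x => \prod_(j <- [:: i]) Fs j x) = Fs i.
    by apply/funext => x; rewrite big_seq1.
  have -> // : prod_density [:: i] = fs i.
  by apply/funext => x /=; rewrite big_nil mulr1 mulr0 addr0.
have -> : (fun x => \prod_(k <- i :: j :: s) Fs k x) =
    (fun x => Fs i x * \prod_(k <- j :: s) Fs k x).
  by apply/funext => x; rewrite big_cons.
exact: (is_cdfM (H i) (IH j)).
Qed.

End Product.
End Cdf.

(** * The distribution function of a probability density *)

Section Density.
Variable R : realType.
Local Notation mu := (@lebesgue_measure R).
Variable f : R -> R.
Hypothesis mf : measurable_fun setT f.
Hypothesis f_ge0 : forall x, 0 <= f x.
Hypothesis f_int1 : (\int[mu]_x (f x)%:E = 1)%E.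
Local Notation F := (Defs.cdf f).

Let mfE (D : set R) : measurable_fun D (EFin \o f).
Proof. exact/measurable_EFinP/measurable_funTS. Qed.

Lemma cdfE x : (\int[mu]_(w in `]-oo, x]) (f w)%:E = (F x)%:E)%E.
Proof.
rewrite /Defs.cdf set_le_itv /Rintegral fineK// ge0_fin_numE; last first.
  by apply: integral_ge0 => w _; rewrite lee_fin.
apply: (@le_lt_trans _ _ (\int[mu]_w (f w)%:E)%E); last by rewrite f_int1 ltry.
by apply: ge0_subset_integral => //; [exact: mfE|move=> w _; rewrite lee_fin].
Qed.

Lemma cdf_ge0 x : 0 <= F x.
Proof. by rewrite -lee_fin -cdfE; apply: integral_ge0 => w _; rewrite lee_fin. Qed.

Lemma cdf_incrE x y : x <= y ->
  (F y - F x)%:E = (\int[mu]_(w in `]x, y]) (f w)%:E)%E.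
Proof.
move=> xy; have := cdfE y.
rewrite (@itv_bndbnd_setU _ _ _ (BRight x))//.
rewrite ge0_integral_setU//; last 3 first.
- exact: mfE.
- by move=> w _; rewrite lee_fin.
- apply/disj_setPS => w /= []; rewrite !in_itv /= => wx /andP[xw _].
  by have := le_lt_trans wx xw; rewrite ltxx.
rewrite cdfE EFinB => <-; rewrite addeAC subee ?add0e//.
Qed.

Lemma cdf_tailE x : (1 - F x)%:E = (\int[mu]_(w in `]x, +oo[) (f w)%:E)%E.
Proof.
have := f_int1; rewrite -(setUv `]-oo, x]%classic).
rewrite ge0_integral_setU//; last 4 first.
- exact: measurableC.
- exact: mfE.
- by move=> w _; rewrite lee_fin.
- exact/disj_setPCl.
rewrite setCitvl /= cdfE EFinB => <-; rewrite addeAC subee ?add0e//.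
Qed.

Lemma cdf_le1 x : F x <= 1.
Proof.
rewrite -subr_ge0 -lee_fin cdf_tailE.
by apply: integral_ge0 => w _; rewrite lee_fin.
Qed.

Lemma cdf_nondecreasing : nondecreasing_fun F.
Proof.
move=> x y xy; rewrite -subr_ge0 -lee_fin cdf_incrE//.
by apply: integral_ge0 => w _; rewrite lee_fin.
Qed.

Lemma measurable_cdf : measurable_fun setT F.
Proof. by apply: nondecreasing_measurable => //; exact: cdf_nondecreasing. Qed.

Lemma cdf_incr_ge x y c : x <= y -> 0 <= c ->
  (forall w, x <= w -> w <= y -> c <= f w) -> c * (y - x) <= F y - F x.
Proof.
move=> xy c0 cf; rewrite -lee_fin cdf_incrE//.
have -> : ((c * (y - x))%:E = \int[mu]_(w in `]x, y]) c%:E)%E.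
  rewrite integral_cst//= lebesgue_measure_itv /= lte_fin.
  case: ltP => [_|yx]; first by rewrite EFinM EFinB.
  by rewrite (le_anti (introT andP (conj xy yx))) subrr mulr0 mule0.
apply: ge0_le_integral => //; last first.
  by move=> w /=; rewrite in_itv /= => /andP[xw wy]; rewrite lee_fin cf// ltW.
exact: mfE.
Qed.

(** The exponential density has total mass one, so its multiple by [k] has mass [k]. *)
Lemma cdf_tail_le x k rate : 0 < rate -> 0 <= k -> 0 <= x ->
  (forall w, x <= w -> f w <= k * exponential_pdf rate w) -> 1 - F x <= k.
Proof.
move=> r0 k0 x0 H; rewrite -lee_fin cdf_tailE.
have me : measurable_fun setT (fun w : R => (exponential_pdf rate w)%:E).
  by apply/measurable_EFinP; exact: measurable_exponential_pdf.
have e0 (w : R) : (0 <= (exponential_pdf rate w)%:E)%E.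
  by rewrite lee_fin exponential_pdf_ge0// ltW.
have -> : (k%:E = \int[mu]_w (k%:E * (exponential_pdf rate w)%:E))%E.
  by rewrite ge0_integralZl// ?integral_exponential_pdf// mule1.
apply: (@le_trans _ _ (\int[mu]_(w in `]x, +oo[) (k%:E * (exponential_pdf rate w)%:E))%E).
  apply: ge0_le_integral => //.
  - by move=> w _; rewrite lee_fin.
  - exact: mfE.
  - by apply: measurable_funeM; exact: measurable_funTS.
  - by move=> w /=; rewrite in_itv /= andbT => /ltW xw; rewrite -EFinM lee_fin H.
apply: ge0_subset_integral => //.
  exact: measurable_funeM.
by move=> w _; rewrite mule_ge0// lee_fin.
Qed.

Lemma is_cdf_shift b : is_cdf (fun x => F (x - b)) (fun x => f (x - b)).
Proof.
have mB : measurable_fun setT (fun x : R => x - b) by exact: measurable_funB.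
split => //.
- exact: (measurableT_comp mf).
- exact: (measurableT_comp measurable_cdf).
- move=> x; rewrite -cdfE integral_mkcond [RHS]integral_mkcond.
  rewrite [RHS](@ge0_integral_affine _ 1 (- b))//; last 2 first.
  + by apply/(measurable_restrictT _ (measurable_itv _)); exact: mfE.
  + by move=> w; rewrite patchE; case: ifP => // _; rewrite lee_fin.
  rewrite mul1e; apply: eq_integral => w _; rewrite !patchE mul1r.
  by rewrite !mem_setE !in_itv /= lerD2r.
- rewrite -f_int1 [RHS](@ge0_integral_affine _ 1 (- b))//.
  by rewrite mul1e; apply: eq_integral => w _; rewrite mul1r.
Qed.

(** * Sampling probabilities: they sum to one and are positive *)

Section Grad.
Variable N : nat.
Implicit Types (G : 'I_N -> R) (i : 'I_N).

(** This is the factor [H]: in the variable [x = G i + w] it does not involve [G i], so it is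
    unaffected when only arm [i] moves. *)
Definition others_cdf G i x := \prod_(j < N | j != i) F (x - G j).

Lemma others_cdf_ge0 G i x : 0 <= others_cdf G i x.
Proof. by apply: prodr_ge0 => j _; exact: cdf_ge0. Qed.

Lemma others_cdf_le1 G i x : others_cdf G i x <= 1.
Proof. 
apply: (@le_trans _ _ (\prod_(j < N | j != i) (1 : R))); last by rewrite big1.
by apply: ler_prod => j _; rewrite cdf_ge0 cdf_le1. Qed.

Lemma measurable_others_cdf G i : measurable_fun setT (others_cdf G i).
Proof.
rewrite (_ : others_cdf G i =
    fun x => \prod_(j < N) (if j != i then F (x - G j) else 1)); last first.
  by apply/funext => x; rewrite /others_cdf big_mkcond.
apply: measurable_prod => j _; case: (j != i) => //.
by case: (is_cdf_shift (G j)).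
Qed.

Lemma integrable_grad G i :
  mu.-integrable setT (EFin \o (fun x => f (x - G i) * others_cdf G i x)).
Proof.
have [m1 _ p1 _ t1] := is_cdf_shift (G i).
have m2 := measurable_others_cdf G i.
apply: (@le_integrableT _ _ (fun x => f (x - G i))) => //.
- exact: measurable_funM.
- move=> x; rewrite ger0_norm ?mulr_ge0// ?others_cdf_ge0//.
  by rewrite ler_piMr// others_cdf_le1.
- by apply: ge0_integrableT => //; rewrite t1 ltry.
Qed.

Lemma smoothed_gradE G i : smoothed_grad f G i =
  Rintegral mu setT (fun x => f (x - G i) * others_cdf G i x).
Proof.
have [m1 _ p1 _ t1] := is_cdf_shift (G i).
rewrite (@Rintegral_translation _ (G i)); last 2 first.
- exact: measurable_funM (measurable_others_cdf G i).
- by move=> x; rewrite mulr_ge0// others_cdf_ge0.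
rewrite /smoothed_grad /others_cdf; apply: eq_Rintegral => w _.
rewrite addrK; congr (_ * _); apply: eq_bigr => j _; congr F; ring.
Qed.

(** In the common variable [x], the integrands add up to the Leibniz derivative of the full product,
    which is the density of the maximum. *)
Lemma sum_smoothed_grad G : (0 < N)%N -> \sum_i smoothed_grad f G i = 1.
Proof.
move=> N0; apply/EFin_inj; rewrite -sumEFin.
under eq_bigr => i _.
  rewrite smoothed_gradE /Rintegral fineK; last first.
    by apply: integrable_fin_num => //; exact: integrable_grad.
  over.
rewrite -ge0_integral_sum//; last 2 first.
- by move=> i; case/integrableP: (integrable_grad G i).
- by move=> i x _; rewrite lee_fin mulr_ge0// others_cdf_ge0.
(* The enumeration of arms is abstracted to a duplicate-free list, nonempty by [N0], as
   [is_cdf_prod] and [prod_densityE] require. *)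
have : uniq (index_enum (Finite.clone _ 'I_N)) by exact: index_enum_uniq.
rewrite /others_cdf /=.
have := mem_index_enum (Ordinal N0 : Finite.clone _ 'I_N).
case: (index_enum _) => [//|i s] _ us.
have [_ _ _ _ <-] := is_cdf_prod i s (fun j => is_cdf_shift (G j)).
by apply: eq_integral => x _; rewrite prod_densityE// sumEFin.
Qed.

Hypothesis f_nonincr : forall x y, 0 <= x -> x <= y -> f y <= f x.
Hypothesis f_gt0 : forall x, 0 <= x -> 0 < f x.

(** On a unit interval far enough to the right, [f] is bounded below by a positive value and every
    other factor is at least [F 1 > 0]. *)
Lemma smoothed_grad_gt0 G i : 0 < smoothed_grad f G i.
Proof.
have F1 : 0 < F 1.
  have := @cdf_incr_ge 0 1 (f 1) ler01 (f_ge0 1) (fun w w0 w1 => f_nonincr w0 w1).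
  rewrite subr0 mulr1 => H; have := f_gt0 ler01; have := cdf_ge0 0; lra.
(* For [x >= m] every [x - G j] is at least 1; the maximum in [m'] keeps the argument of [f] in the
   range where [f] is monotone. *)
pose m := 1 + \sum_j `|G j|.
have m1 : 1 <= m by rewrite lerDl sumr_ge0.
have Gm j : G j + 1 <= m.
  rewrite /m addrC lerD2l (bigD1 j)//= (le_trans (ler_norm _))// lerDl.
  exact: sumr_ge0.
pose m' := Num.max (m - G i) 0.
have m'0 : 0 <= m' by rewrite le_max lexx orbT.
have m'G : m - G i <= m' by rewrite le_max lexx.
pose c := f (m' + 1) * F 1 ^+ #|[pred j | j != i]|.
have c0 : 0 < c.
  by rewrite /c mulr_gt0 ?exprn_gt0// f_gt0// addr_ge0.
apply: (@lt_le_trans _ _ c) => //.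
rewrite smoothed_gradE.
have -> : c = Rintegral mu setT (fun x => c * \1_(`[m' + G i, m' + G i + 1]%classic : set R) x).
  rewrite RintegralZl//; last exact: integrable_indic_itv.
  by rewrite Rintegral_indic_itv ?lerDl// addrAC subrr add0r mulr1.
apply: le_Rintegral => //.
- by apply: integrableZT; exact: integrable_indic_itv.
- exact: integrable_grad.
move=> x _; rewrite indicE mem_setE in_itv /=.
case: (boolP (m' + G i <= x <= m' + G i + 1)) => /=; last first.
  by move=> _; rewrite mulr0 mulr_ge0// others_cdf_ge0.
move=> /andP[ax xb]; rewrite mulr1 /c; apply: ler_pM => //.
- by rewrite exprn_ge0// cdf_ge0.
- by apply: f_nonincr; lra.
rewrite -prodr_const; apply: ler_prod => j _; apply/andP; split; first exact: cdf_ge0.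
apply: cdf_nondecreasing.
have := Gm j; lra.
Qed.

(** * The smoothed potential: integrability and lower bound *)

Hypothesis f_neg : forall x, x < 0 -> f x = 0.

Lemma cdf_neg x : x < 0 -> F x = 0.
Proof.
move=> x0; apply/EFin_inj; rewrite -cdfE integral0_eq// => w /=.
by rewrite in_itv /= => wx; rewrite f_neg// (le_lt_trans wx).
Qed.

(* This is [E max_j (G j + W j)]: the product is the distribution function of the maximum. *)
Definition potential G :=
  Rintegral mu setT (fun x => (0 <= x)%R%:R - \prod_(j < N) F (x - G j)).

(** An integrable majorant of the tail of the maximum of [N] perturbations; it makes the potential
    finite for [G <= 0] and bounds it at the origin. *)
Variable q : R -> R.
Hypothesis q_integrable : mu.-integrable setT (EFin \o q).
Hypothesis q_ge0 : forall x, 0 <= q x.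
Hypothesis q_tail : forall x, 0 <= x -> 1 - F x ^+ N <= q x.

Let prodF_ge0 G x : 0 <= \prod_(j < N) F (x - G j).
Proof. by apply: prodr_ge0 => j _; exact: cdf_ge0. Qed.

Let prodF_le1 G x : \prod_(j < N) F (x - G j) <= 1.
Proof.
apply: (@le_trans _ _ (\prod_(j < N) (1 : R))); last by rewrite big1.
by apply: ler_prod => j _; rewrite cdf_ge0 cdf_le1.
Qed.

Let prodF_eq0 G i x : x < G i -> \prod_(j < N) F (x - G j) = 0.
Proof. by move=> xG; rewrite (bigD1 i)//= cdf_neg ?mul0r// subr_lt0. Qed.

(** Left of [G i] the factor of arm [i] vanishes, so the integrand can be negative only on
    [[G i, 0]], where it is at least [-1]. *)
Lemma potential_integrand_ge G i x :
  - \1_(`[G i, 0]%classic : set R) x <= (0 <= x)%R%:R - \prod_(j < N) F (x - G j).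
Proof.
rewrite indicE mem_setE in_itv /=.
have := prodF_ge0 G x; have := prodF_le1 G x.
case: (leP 0 x) => x0 /=; first by case: (_ && _) => /=; lra.
rewrite (ltW x0) andbT; case: (leP (G i) x) => [_|xG] /=; first lra.
by rewrite (prodF_eq0 xG); lra.
Qed.

Lemma potential_integrand_norm_le G i x : (forall j, G j <= 0) ->
  `|(0 <= x)%R%:R - \prod_(j < N) F (x - G j)|
    <= \1_(`[G i, 0]%classic : set R) x + q x.
Proof.
move=> G0; have := potential_integrand_ge G i x; have := q_ge0 x.
have : 0 <= \1_(`[G i, 0]%classic : set R) x :> R by [].
have := prodF_ge0 G x.
rewrite ler_norml; case: (leP 0 x) => x0 /=; last by lra.
have : F x ^+ N <= \prod_(j < N) F (x - G j).
  rewrite -[X in F x ^+ X]card_ord -prodr_const; apply: ler_prod => j _.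
  by rewrite cdf_ge0/= cdf_nondecreasing// lerDl oppr_ge0.
have := q_tail x0; lra.
Qed.

Lemma measurable_potential_integrand G :
  measurable_fun setT (fun x : R => (0 <= x)%R%:R - \prod_(j < N) F (x - G j)).
Proof.
apply: measurable_funB.
  rewrite (_ : (fun x : R => (0 <= x)%R%:R) = \1_(`[0, +oo[%classic : set R)).
    exact: measurable_indic.
  by apply/funext => x; rewrite indicE mem_setE in_itv /= andbT.
apply: measurable_prod => j _; by case: (is_cdf_shift (G j)).
Qed.

Lemma integrable_potential_integrand G : 'I_N -> (forall j, G j <= 0) ->
  mu.-integrable setT
    (EFin \o (fun x => (0 <= x)%R%:R - \prod_(j < N) F (x - G j))).
Proof.
move=> i G0.
apply: (@le_integrableT _ _ (fun x => \1_(`[G i, 0]%classic : set R) x + q x)).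
- exact: measurable_potential_integrand.
- by move=> x; exact: potential_integrand_norm_le.
- by apply: integrableDT => //; exact: integrable_indic_itv.
Qed.

(** The lower bound of the integrand, minus the indicator of [[G i, 0]], integrates to exactly
    [G i]. *)
Lemma potential_ge G i : (forall j, G j <= 0) -> G i <= potential G.
Proof.
move=> G0; have -> : G i =
    Rintegral mu setT (fun x => -1 * \1_(`[G i, 0]%classic : set R) x).
  rewrite RintegralZl//; last exact: integrable_indic_itv.
  by rewrite Rintegral_indic_itv// sub0r mulN1r opprK.
apply: le_Rintegral => //.
- by apply: integrableZT; exact: integrable_indic_itv.
- exact: integrable_potential_integrand.
- by move=> x _; rewrite mulN1r; exact: potential_integrand_ge.
Qed.

Lemma potential0_le : 'I_N -> potential (fun=> 0) <= Rintegral mu setT q.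
Proof.
move=> i; apply: le_Rintegral => //; first exact: integrable_potential_integrand.
move=> x _; have := prodF_ge0 (fun=> 0) x; have := q_ge0 x.
case: (leP 0 x) => x0 /=; last by lra.
have := q_tail x0; under eq_bigr do rewrite subr0.
by rewrite prodr_const card_ord.
Qed.

(** * Change of the potential when one coordinate drops by [z] *)

Section Step.
Variables (G G' : 'I_N -> R) (i : 'I_N) (z : R).
Hypothesis z_ge0 : 0 <= z.
Hypothesis G_le0 : forall j, G j <= 0.
Hypothesis G'i : G' i = G i - z.
Hypothesis G'j : forall j, j != i -> G' j = G j.

Let G'_le0 j : G' j <= 0.
Proof.
have := G_le0 j; case: (eqVneq j i) => [->|/G'j -> //]; rewrite G'i.
have := z_ge0; lra.
Qed.

Let decr_integrandE x :
  ((0 <= x)%R%:R - \prod_(j < N) F (x - G' j))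
  - ((0 <= x)%R%:R - \prod_(j < N) F (x - G j))
  = (F (x - G i) - F (x - G i + z)) * others_cdf G i x.
Proof.
rewrite (bigD1 i)//= [X in _ - (_ - X)](bigD1 i)//= /others_cdf G'i.
rewrite [X in _ - _ * X - _](eq_bigr (fun j => F (x - G j))); last first.
  by move=> j /G'j ->.
have -> : x - (G i - z) = x - G i + z by ring.
ring.
Qed.

Let integrable_decr : mu.-integrable setT (EFin \o
  (fun x => (F (x - G i) - F (x - G i + z)) * others_cdf G i x)).
Proof.
have -> : (fun x => (F (x - G i) - F (x - G i + z)) * others_cdf G i x) =
   (fun x => ((0 <= x)%R%:R - \prod_(j < N) F (x - G' j))
  - ((0 <= x)%R%:R - \prod_(j < N) F (x - G j))).
  by apply/funext => x; rewrite decr_integrandE.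
by apply: integrableBT; exact: integrable_potential_integrand.
Qed.

Let potential_decrE : potential G' - potential G =
  Rintegral mu setT (fun x => (F (x - G i) - F (x - G i + z)) * others_cdf G i x).
Proof.
rewrite /potential -RintegralB//; try exact: integrable_potential_integrand.
by apply: eq_Rintegral => x _; exact: decr_integrandE.
Qed.

Lemma potential_decr_le : potential G' <= potential G.
Proof.
rewrite -subr_le0 potential_decrE -oppr_ge0 -mulN1r -RintegralZl//.
apply: Rintegral_ge0 => x _; rewrite mulN1r -mulNr opprB mulr_ge0//.
  by rewrite subr_ge0 cdf_nondecreasing// lerDl.
exact: others_cdf_ge0.
Qed.

Variables (A : R) (r : R -> R).
Hypothesis mr : measurable_fun setT r.
Hypothesis r_ge0 : forall x, 0 <= r x.
Hypothesis r_integrable : mu.-integrable setT (EFin \o r).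
Hypothesis f_drop : forall u y, 0 <= u -> 0 <= y ->
  f u - f (u + y) <= y * (A * f u + r u).

Lemma potential_bregman_le :
  potential G' - potential G + z * smoothed_grad f G i
    <= z ^+ 2 * (A * smoothed_grad f G i + Rintegral mu setT r).
Proof.
have ig := integrable_grad G i.
have ir : mu.-integrable setT (EFin \o (fun x => r (x - G i))).
  apply: ge0_integrableT => //.
    by apply: (measurableT_comp mr); exact: measurable_funB.
  move: r_integrable => /integrableP[_].
  under eq_integral do rewrite /= ger0_norm//.
  rewrite (@ge0_integral_affine _ 1 (- G i) (fun x => (r x)%:E))//; last exact/measurable_EFinP.
  rewrite mul1e.
  by under eq_integral do rewrite mul1r.
rewrite potential_decrE (Rintegral_translation (- G i) mr r_ge0) smoothed_gradE.
rewrite -!RintegralZl// -!RintegralD//; try exact: integrableZT.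
rewrite -RintegralZl//; last by apply: integrableDT => //; exact: integrableZT.
apply: le_Rintegral => //.
- by apply: integrableDT => //; exact: integrableZT.
- by apply: integrableZT; apply: integrableDT => //; exact: integrableZT.
move=> x _; set u := x - G i.
have H0 := others_cdf_ge0 G i x; have H1 := others_cdf_le1 G i x.
set H := others_cdf G i x in H0 H1 *.
(* The term with [A] keeps [H] and integrates back to the sampling probability; the remainder [r]
   needs only [H <= 1]. *)
have ru : r u * H <= r u by rewrite ler_piMr.
have zz : 0 <= z ^+ 2 by rewrite sqr_ge0.
apply: (@le_trans _ _ (z ^+ 2 * (A * f u + r u) * H)); last first.
  rewrite -mulrA; apply: ler_wpM2l => //; nra.
rewrite [z * (f u * H)]mulrA -mulrDl; apply: ler_wpM2r => //.
case: (ltP u 0) => u0.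
  rewrite (f_neg u0) !mulr0 add0r addr0.
  apply: (@le_trans _ _ 0); last by rewrite mulr_ge0.
  by rewrite subr_le0 cdf_nondecreasing// lerDl.
(* As [f] is nonincreasing right of 0, [F] gains at least [z * f (u + z)] over [[u, u + z]];
   [f_drop] then compares this with [z * f u]. *)
have : f (u + z) * (u + z - u) <= F (u + z) - F u.
  apply: cdf_incr_ge => //; first by rewrite lerDl.
  by move=> w uw wu; apply: f_nonincr => //; exact: le_trans uw.
have := f_drop u0 z_ge0; rewrite expr2 => fd.
have : z * (f u - f (u + z)) <= z * (z * (A * f u + r u)) by apply: ler_wpM2l.
nra.
Qed.

End Step.

(** * The one-round inequality and the resulting regret bound *)

Section Regret.
Variables (A s : R) (r : R -> R).
Hypothesis A_ge0 : 0 <= A.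
Hypothesis s_gt0 : 0 < s.
Hypothesis mr : measurable_fun setT r.
Hypothesis r_ge0 : forall x, 0 <= r x.
Hypothesis r_integrable : mu.-integrable setT (EFin \o r).
Hypothesis r_small : Rintegral mu setT r <= s ^+ 2.
Hypothesis f_drop : forall u y, 0 <= u -> 0 <= y ->
  f u - f (u + y) <= y * (A * f u + r u).

(* When [p <= s] the trivial bound [1] on the Bregman term is used, otherwise the
   second-order one. *)
Lemma potential_step1 G (h : 'I_N -> R) a : (forall j, G j <= 0) ->
  (forall j, -1 <= h j <= 0) ->
  smoothed_grad f G a * potential (estimator_step (smoothed_grad f) h G a)
    <= smoothed_grad f G a * potential G + smoothed_grad f G a * h a + (A + s).
Proof.
move=> G0 h01; set p := smoothed_grad f G a; have p0 : 0 < p := smoothed_grad_gt0 G a.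
have /andP[h1 h0] := h01 a.
pose z := - h a / p.
have zp : z * p = - h a by rewrite /z mulfVK// gt_eqF.
have z0 : 0 <= z by rewrite divr_ge0 ?oppr_ge0// ltW.
set G' := estimator_step _ _ _ _.
have G'a : G' a = G a - z by rewrite /G' /estimator_step eqxx /z mulNr opprK.
have G'j j : j != a -> G' j = G j.
  by rewrite eq_sym => /negbTE ja; rewrite /G' /estimator_step ja addr0.
have d1 := potential_decr_le z0 G0 G'a G'j.
have d2 := potential_bregman_le z0 G0 G'a G'j mr r_ge0 r_integrable f_drop.
rewrite -/p in d2.
have -> : h a = - (z * p) by rewrite zp opprK.
case: (leP p s) => ps.
  have : p * (z * p) <= p by rewrite zp; apply: ler_piMr; [exact: ltW|lra].
  have : p * potential G' <= p * potential G by rewrite ler_pM2l.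
  move=> X1 X2; rewrite mulrN; apply: (le_trans X1); rewrite -addrA lerDl addrC subr_ge0.
  by apply: (le_trans X2); apply: (le_trans ps); rewrite lerDr.
suff : p * (z ^+ 2 * (A * p + Rintegral mu setT r)) <= A + s.
  have : p * (potential G' - potential G + z * p) <=
    p * (z ^+ 2 * (A * p + Rintegral mu setT r)) by rewrite ler_pM2l.
  lra.
(* Weighting by [p] isolates [(z * p) ^+ 2 = (h a) ^+ 2 <= 1]; the remainder over [p] is at most
   [s ^+ 2 / p], below [s] because [s < p]. *)
have -> : p * (z ^+ 2 * (A * p + Rintegral mu setT r)) =
  (z * p) ^+ 2 * (A + Rintegral mu setT r / p) by field; rewrite gt_eqF.
have k1 : (z * p) ^+ 2 <= 1 by rewrite zp sqrrN expr2; nra.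
have k0 : 0 <= Rintegral mu setT r / p.
  by rewrite divr_ge0 ?(ltW p0)// Rintegral_ge0.
have k2 : Rintegral mu setT r / p <= s.
  rewrite ler_pdivrMr//; apply: (le_trans r_small).
  by rewrite expr2 ler_pM2l// ltW.
apply: (@le_trans _ _ (A + Rintegral mu setT r / p)); last by rewrite lerD2l.
by rewrite ler_piMl// addr_ge0.
Qed.

(** Each arm costs at most [A + s] per round, so the potential argument applies with
    [B = N * (A + s)]. *)
Lemma smoothed_grad_regret_le T (g : 'I_T -> 'I_N -> R) : (0 < N)%N ->
  (forall t j, -1 <= g t j <= 0) ->
  expected_regret (smoothed_grad f) g
    <= Rintegral mu setT q + T%:R * (N%:R * (A + s)).
Proof.
move=> N0 g01; apply: (@le_trans _ _ (potential (fun=> 0) + T%:R * (N%:R * (A + s)))).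
  apply: expected_regret_le => //.
  - exact: smoothed_grad_gt0.
  - by move=> G; exact: sum_smoothed_grad.
  - move=> G h G0 h01.
    apply: (@le_trans _ _ (\sum_a (smoothed_grad f G a * potential G +
        smoothed_grad f G a * h a + (A + s)))).
      by apply: ler_sum => a _; exact: potential_step1.
    rewrite !big_split /= -mulr_suml sum_smoothed_grad// mul1r.
    by rewrite -[X in _ + _ + X]big_split /= sumr_const card_ord mulr_natl.
  - by move=> G i; exact: potential_ge.
by rewrite lerD2r potential0_le//; exact: (Ordinal N0).
Qed.

End Regret.
End Grad.
End Density.

(** * Elementary inequalities for powers and exponentials *)

Section Inequalities.
Variable R : realType.
Implicit Types x y z t v w a b m lam th : R.

(** Young's inequality for [t] and 1, with conjugate exponents [b] and [b / (b - 1)]. *)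
Lemma powR_ge_tangent b t : 1 < b -> 0 <= t -> 1 + b * (t - 1) <= t `^ b.
Proof.
move=> b1 t0; have b0 : 0 < b by exact: lt_trans b1.
have H : b^-1 + (b / (b - 1))^-1 = 1.
  by rewrite invf_div -{1}[b^-1]mul1r -mulrDl addrC subrK mulfV ?gt_eqF.
have q0 : 0 < b / (b - 1) by rewrite divr_gt0// subr_gt0.
have := conjugate_powR t0 ler01 b0 q0 H; rewrite mulr1 powR1 div1r => tle.
have -> : 1 + b * (t - 1) = b * (t - (1 - b^-1)) by field; rewrite gt_eqF.
rewrite mulrC -ler_pdivlMr//.
have : (b / (b - 1))^-1 = 1 - b^-1 by apply/esym/eqP; rewrite subr_eq addrC H.
lra.
Qed.

(** The tangent inequality at [v / (v + y)], multiplied by [(v + y) ^ b]. *)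
Lemma powR_diff_le b v y : 1 < b -> 0 <= v -> 0 <= y ->
  (v + y) `^ b - v `^ b <= y * (b * (v + y) `^ (b - 1)).
Proof.
move=> b1 v0 y0; have b0 : 0 < b by exact: lt_trans b1.
have := addr_ge0 v0 y0; rewrite le_eqVlt => /predU1P[vy0|vy].
  have /eqP : v + y = 0 by [].
  rewrite paddr_eq0// => /andP[/eqP-> /eqP->].
  by rewrite addr0 subrr mul0r.
have t0 : 0 <= v / (v + y) by rewrite divr_ge0// ltW.
have E : v = v / (v + y) * (v + y) by rewrite divfK// gt_eqF.
have := powR_ge_tangent b1 t0.
have vbE : v `^ b = (v / (v + y)) `^ b * (v + y) `^ b.
  by rewrite {1}E powRM// ltW.
have wE : (v + y) * (v + y) `^ (b - 1) = (v + y) `^ b by rewrite mulr_powRB1// ltW.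
have w0 : 0 <= (v + y) `^ b := powR_ge0 _ _.
move=> H; have : (1 + b * (v / (v + y) - 1)) * (v + y) `^ b <= v `^ b.
  by rewrite vbE ler_wpM2r.
have -> : (1 + b * (v / (v + y) - 1)) * (v + y) `^ b =
  (v + y) `^ b - y * (b * (v + y) `^ (b - 1)).
  rewrite -wE; field; rewrite gt_eqF//.
lra.
Qed.

(** For [y <= 1], use [1 - expR (- d) <= d] and [v + y <= 1 + v]. For [y > 1] the factor on the
    right already exceeds 1, so the trivial bound suffices. *)
Lemma expRN_powR_drop b v y : 1 < b -> 0 <= v -> 0 <= y ->
  expR (- (v `^ b)) - expR (- ((v + y) `^ b))
    <= expR (- (v `^ b)) * (y * (b * (1 + v) `^ (b - 1))).
Proof.
move=> b1 v0 y0; set d := (v + y) `^ b - v `^ b.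
have -> : expR (- ((v + y) `^ b)) = expR (- (v `^ b)) * expR (- d).
  by rewrite -expRD; congr expR; rewrite /d; ring.
rewrite -[X in X - _]mulr1 -mulrBr ler_pM2l ?expR_gt0//.
have p1 : 1 <= (1 + v) `^ (b - 1).
  rewrite -[leLHS](powRr0 (1 + v)) ler_powR ?lerDl// subr_ge0; exact: ltW.
case: (leP y 1) => y1.
  apply: (@le_trans _ _ d); first by have := expR_ge1Dx (- d); lra.
  apply: (le_trans (powR_diff_le b1 v0 y0)).
  rewrite ler_wpM2l// ler_wpM2l//; first by rewrite ltW// (lt_trans ltr01).
  apply: ge0_ler_powR; [lra|rewrite nnegrE; lra|rewrite nnegrE; lra|lra].
have := expR_gt0 (- d).
have : 1 <= b * (1 + v) `^ (b - 1) by apply: mulr_ege1 => //; exact: ltW.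
nra.
Qed.

Lemma expRN_powR_le b z : 1 < b -> 0 <= z ->
  expR (- (z `^ b)) <= expR 1 * expR (- z).
Proof.
move=> b1 z0; rewrite -expRD ler_expR.
have := powR_ge_tangent b1 z0; have := powR_ge0 z b.
by case: (leP z 1) => z1; nra.
Qed.

(** From [ln w <= w - 1] at [w = (1 + v) / (2 * m)], where [2 * m] is chosen to give slope [1/2] in
    [v]; a term [- m] is discarded. *)
Lemma powR1D_le_expR m v : 0 < m -> 0 <= v ->
  (1 + v) `^ m <= expR (2^-1 + m * ln (2 * m)) * expR (v / 2).
Proof.
move=> m0 v0; have v1 : 0 < 1 + v by rewrite ltr_pwDl.
rewrite /powR gt_eqF// -expRD ler_expR.
have m2 : 0 < 2 * m by rewrite mulr_gt0.
have w0 : 0 < (1 + v) / (2 * m) by rewrite divr_gt0.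
have : ln ((1 + v) / (2 * m)) <= (1 + v) / (2 * m) - 1.
  move: w0; set w := (_ / _) => w0.
  by have := @le_ln1Dx R (w - 1); rewrite addrCA subrr addr0; apply; lra.
rewrite ln_div ?posrE// => H.
have : m * (ln (1 + v) - ln (2 * m)) <= m * ((1 + v) / (2 * m) - 1) by rewrite ler_pM2l.
have -> : m * ((1 + v) / (2 * m) - 1) = (1 + v) / 2 - m by field; rewrite gt_eqF.
lra.
Qed.

(* Truncation at level [lam]: above it, a power of [w / lam] is at least [1]. *)
Lemma le_truncation w lam a : 0 <= w -> 0 < lam -> 0 <= a ->
  w <= lam + w `^ (1 + a) / lam `^ a.
Proof.
move=> w0 l0 a0; have la := powR_gt0 a l0.
case: (leP w lam) => wl; first by rewrite (le_trans wl)// lerDl divr_ge0// powR_ge0.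
have w1 : 0 < w by exact: lt_trans wl.
rewrite powRD; last by rewrite (gt_eqF w1) implybT.
rewrite powRr1// -mulrA; apply: ler_wpDl; first exact: ltW.
apply: ler_peMr => //; rewrite ler_pdivlMr// mul1r.
by apply: ge0_ler_powR; rewrite ?nnegrE// ltW.
Qed.

Lemma bernoulli_le x n : 0 <= x <= 1 -> 1 - x ^+ n <= n%:R * (1 - x).
Proof.
move=> /andP[x0 x1]; elim: n => [|n IH]; first by rewrite expr0 subrr mul0r.
have xn1 : x ^+ n <= 1 by rewrite exprn_ile1.
rewrite exprS -natr1.
have := exprn_ge0 n x0; nra.
Qed.

(** Lets a bound on a probability be raised to a small power, which will turn the factor [N] of a
    union bound into [N ^ th]. *)
Lemma le_powR_of_le1 x y th : 0 <= y -> 0 < th <= 1 -> x <= 1 -> x <= y -> x <= y `^ th.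
Proof.
move=> y0 /andP[th0 th1] x1 xy; case: (leP y 1) => y1.
  move: y0; rewrite le_eqVlt => /predU1P[y0|y0].
    by rewrite -y0 powR0 ?gt_eqF// y0.
  by apply: (le_trans xy); rewrite ger1_powR// y0.
apply: (le_trans x1); rewrite -[leLHS](powRr0 y) ler_powR//; exact: ltW.
Qed.

End Inequalities.

(** * The density of the perturbation: normalization and positivity *)

Section BetaDensity.
Variables (R : realType) (beta : R).
Hypothesis beta_gt1 : 1 < beta.
Local Notation mu := (@lebesgue_measure R).

Lemma Rintegral_exponential_pdf (rate : R) : 0 < rate ->
  Rintegral mu setT (exponential_pdf rate) = 1.
Proof. by move=> r0; rewrite /Rintegral integral_exponential_pdf. Qed.

Definition phi_beta (z : R) : R := if 0 <= z then expR (- (z `^ beta)) else 0.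

Lemma phi_beta_ge0 z : 0 <= phi_beta z.
Proof. by rewrite /phi_beta; case: ifP => // _; exact: expR_ge0. Qed.

Lemma measurable_phi_beta : measurable_fun setT phi_beta.
Proof.
apply: measurable_fun_ifT => //; first exact: measurable_fun_ler.
apply: measurableT_comp; first exact: measurable_expR.
apply: measurable_funN; exact: measurable_powR.
Qed.

Lemma phi_beta_le_exp z : phi_beta z <= expR 1 * exponential_pdf 1 z.
Proof.
rewrite /phi_beta; case: ifP => z0.
  by rewrite exponential_pdfE// mul1r mulN1r expRN_powR_le.
by rewrite mulr_ge0 ?expR_ge0// exponential_pdf_ge0.
Qed.

Lemma integrable_phi_beta : mu.-integrable setT (EFin \o phi_beta).
Proof.
apply: (@le_integrableT _ _ (fun z => expR 1 * exponential_pdf 1 z)).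
- exact: measurable_phi_beta.
- by move=> z; rewrite ger0_norm ?phi_beta_ge0// phi_beta_le_exp.
- by apply: integrableZT; exact: integrable_exponential_pdf.
Qed.

Lemma CbetaE : Cbeta beta = (Rintegral mu setT phi_beta)^-1.
Proof.
rewrite /Cbeta Rintegral_mkcond; congr (_^-1); apply: eq_Rintegral => z _.
by rewrite patchE /phi_beta mem_setE.
Qed.

Lemma Rintegral_phi_beta_gt0 : 0 < Rintegral mu setT phi_beta.
Proof.
apply: (@lt_le_trans _ _ (expR (-1))); first exact: expR_gt0.
have -> : expR (-1) =
    Rintegral mu setT (fun x => expR (-1) * \1_(`[0, 1]%classic : set R) x).
  rewrite RintegralZl//; last exact: integrable_indic_itv.
  by rewrite Rintegral_indic_itv ?ler01// subr0 mulr1.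
apply: le_Rintegral => //.
- by apply: integrableZT; exact: integrable_indic_itv.
- exact: integrable_phi_beta.
move=> z _; rewrite indicE mem_setE in_itv /=.
case: (boolP (0 <= z <= 1)) => /=; last by rewrite mulr0 phi_beta_ge0.
move=> /andP[z0 z1]; rewrite mulr1 /phi_beta z0 ler_expR lerN2.
have <- : 1 `^ beta = 1 :> R by rewrite powR1.
by apply: ge0_ler_powR; rewrite ?nnegrE// ltW// (lt_trans ltr01).
Qed.

Lemma Cbeta_gt0 : 0 < Cbeta beta.
Proof. by rewrite CbetaE invr_gt0 Rintegral_phi_beta_gt0. Qed.

Lemma fbetaE z : fbeta beta z = Cbeta beta * phi_beta z.
Proof. by rewrite /fbeta /phi_beta; case: ifP => // _; rewrite mulr0. Qed.

Lemma integral_fbeta : (\int[mu]_z (fbeta beta z)%:E = 1)%E.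
Proof.
under eq_integral do rewrite fbetaE EFinM.
rewrite integralZl//; last exact: integrable_phi_beta.
rewrite -[X in (_ * X)%E]fineK; last first.
  by apply: integrable_fin_num => //; exact: integrable_phi_beta.
by rewrite -EFinM CbetaE mulVf// gt_eqF// Rintegral_phi_beta_gt0.
Qed.

(* Bounds [expR (- v `^ beta) * (1 + v) `^ ((beta - 1) * (1 + eps^-1))] by a multiple
   of [expR (- (v / 2))]. *)
Definition moment_const (eps : R) : R :=
  let m := (beta - 1) * (1 + eps^-1) in
  expR 1 * expR (2^-1 + m * ln (2 * m)).

(** * The scaled density: tails and one-sided drop *)

Section Scaled.
Variable eta : R.
Hypothesis eta_gt0 : 0 < eta.
Local Notation f := (scaled_density (fbeta beta) eta).
Let c := Cbeta beta * expR 1.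

Let c_gt0 : 0 < c.
Proof. by rewrite mulr_gt0 ?Cbeta_gt0// expR_gt0. Qed.

Lemma scaled_fbetaE w : 0 <= w ->
  f w = Cbeta beta / eta * expR (- ((w / eta) `^ beta)).
Proof.
move=> w0; rewrite /scaled_density fbetaE /phi_beta ifT; last first.
  by rewrite divr_ge0// ltW.
by rewrite mulrAC.
Qed.

Lemma scaled_fbeta_ge0 w : 0 <= f w.
Proof.
rewrite /scaled_density fbetaE divr_ge0 ?(ltW eta_gt0)// mulr_ge0 ?phi_beta_ge0//.
exact: ltW Cbeta_gt0.
Qed.

Lemma scaled_fbeta_gt0 w : 0 <= w -> 0 < f w.
Proof.
by move=> w0; rewrite scaled_fbetaE// mulr_gt0 ?expR_gt0// divr_gt0// Cbeta_gt0.
Qed.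

Lemma scaled_fbeta_neg w : w < 0 -> f w = 0.
Proof.
move=> w0; rewrite /scaled_density fbetaE /phi_beta ifF ?mulr0 ?mul0r//.
by apply/negbTE; rewrite -ltNge pmulr_llt0// invr_gt0.
Qed.

Lemma scaled_fbeta_nonincr x y : 0 <= x -> x <= y -> f y <= f x.
Proof.
move=> x0 xy; have y0 := le_trans x0 xy; rewrite !scaled_fbetaE//.
rewrite ler_pM2l ?divr_gt0 ?Cbeta_gt0// ler_expR lerN2.
apply: ge0_ler_powR; rewrite ?nnegrE ?divr_ge0// ?(ltW eta_gt0)//.
  by rewrite ltW// (lt_trans ltr01).
by rewrite ler_pM2r// invr_gt0.
Qed.

Lemma measurable_scaled_fbeta : measurable_fun setT f.
Proof.
rewrite (_ : f = fun w => Cbeta beta / eta * phi_beta (w / eta)).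
  apply: measurable_funM => //.
  apply: (measurableT_comp measurable_phi_beta); exact: measurable_funM.
by apply/funext => w; rewrite /scaled_density fbetaE mulrAC.
Qed.

Lemma integral_scaled_fbeta : (\int[mu]_w (f w)%:E = 1)%E.
Proof.
rewrite (@ge0_integral_affine _ eta 0)//; last 2 first.
- by apply/measurable_EFinP; exact: measurable_scaled_fbeta.
- by move=> w; rewrite lee_fin scaled_fbeta_ge0.
rewrite -ge0_integralZl//; last 3 first.
- apply/measurable_EFinP; apply: (measurableT_comp measurable_scaled_fbeta).
  by apply: measurable_funD => //; exact: measurable_funM.
- by move=> w _; rewrite lee_fin scaled_fbeta_ge0.
- by rewrite lee_fin ltW.
rewrite -integral_fbeta; apply: eq_integral => w _.
rewrite -EFinM /scaled_density addr0; congr (_%:E).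
by rewrite mulrCA mulfV ?gt_eqF// mulr1 [eta * w]mulrC mulfK// gt_eqF.
Qed.

(** Half of the decay [expR (- (w / eta))] is spent on the value at [x <= w]; the other half is an
    exponential density of rate [1 / (2 * eta)], whose normalization yields the factor 2. *)
Lemma cdf_scaled_fbeta_tail x : 0 <= x ->
  1 - Defs.cdf f x <= 2 * c * expR (- (x / (2 * eta))).
Proof.
move=> x0; have e2 : 0 < 2 * eta by rewrite mulr_gt0.
have r0 : 0 < (2 * eta)^-1 by rewrite invr_gt0.
apply: (cdf_tail_le measurable_scaled_fbeta scaled_fbeta_ge0 integral_scaled_fbeta r0) => //.
  by rewrite mulr_ge0 ?expR_ge0// mulr_ge0// ltW.
move=> w xw; have w0 := le_trans x0 xw.
rewrite exponential_pdfE// scaled_fbetaE//.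
have -> : 2 * c * expR (- (x / (2 * eta))) *
    ((2 * eta)^-1 * expR (- (2 * eta)^-1 * w)) =
  Cbeta beta / eta * (expR 1 * expR (- (x / (2 * eta)) - w / (2 * eta))).
  rewrite expRD mulNr [(2 * eta)^-1 * w]mulrC /c; field.
  by rewrite gt_eqF.
rewrite ler_pM2l ?divr_gt0 ?Cbeta_gt0//.
apply: le_trans (expRN_powR_le beta_gt1 _) _; first by rewrite divr_ge0// ltW.
rewrite ler_pM2l ?expR_gt0// ler_expR.
rewrite -opprD lerN2 -mulrDl ler_pdivrMr//.
have -> : w / eta * (2 * eta) = w + w by field; rewrite gt_eqF.
by rewrite lerD2r.
Qed.

(** A union bound costs a factor [N]; raising to the power [th] reduces it to [N ^ th] and slows the
    decay rate to [th / (2 * eta)]. *)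
Lemma cdf_scaled_fbeta_powN_tail N th x : 0 < th <= 1 -> 0 <= x ->
  1 - Defs.cdf f x ^+ N <=
  (2 * c * N%:R) `^ th * (2 * eta / th) * exponential_pdf (th / (2 * eta)) x.
Proof.
move=> /[dup] th01 /andP[th0 th1] x0.
have mf := measurable_scaled_fbeta; have f0 := scaled_fbeta_ge0.
have i1 := integral_scaled_fbeta.
have F0 := cdf_ge0 mf f0 i1 x; have F1 := cdf_le1 mf f0 i1 x.
have e2 : 0 < 2 * eta by rewrite mulr_gt0.
have cN : 0 <= 2 * c * N%:R by rewrite mulr_ge0// mulr_ge0// ltW.
rewrite exponential_pdfE//.
apply: (@le_trans _ _ ((2 * c * N%:R * expR (- (x / (2 * eta)))) `^ th)).
  apply: le_powR_of_le1 => //.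
  - by rewrite mulr_ge0 ?expR_ge0.
  - by rewrite lerBlDr lerDl exprn_ge0.
  - apply: (@le_trans _ _ (N%:R * (1 - Defs.cdf f x))).
      by apply: bernoulli_le; rewrite F0 F1.
    rewrite mulrAC [_ * N%:R]mulrC ler_wpM2l// cdf_scaled_fbeta_tail//.
rewrite powRM ?expR_ge0// -expRM /=.
have -> : - (th / (2 * eta)) * x = - (x / (2 * eta)) * th by ring.
rewrite [leRHS](_ : _ = (2 * c * N%:R) `^ th * expR (- (x / (2 * eta)) * th))//.
by field; rewrite !gt_eqF.
Qed.

Lemma scaled_fbeta_drop X eps u y : 0 < X -> 0 < eps -> 0 <= u -> 0 <= y ->
  f u - f (u + y) <= y * (beta * X `^ eps / eta * f u +
    2 * Cbeta beta * beta * moment_const eps / (X * eta) *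
      exponential_pdf (2 * eta)^-1 u).
Proof.
move=> X0 e0 u0 y0; rewrite /moment_const; set m := _ * (1 + _); set M := expR 1 * _.
have m0 : 0 < m by rewrite mulr_gt0 ?subr_gt0// ltr_wpDr// invr_ge0 ltW.
have uy0 : 0 <= u + y by rewrite addr_ge0.
rewrite exponential_pdfE// !scaled_fbetaE// -mulrBr.
set v := u / eta; have v0 : 0 <= v by rewrite divr_ge0// ltW.
have v1 : 0 < 1 + v by rewrite ltr_pwDl.
have C0 := Cbeta_gt0; have b0 : 0 < beta by exact: lt_trans beta_gt1.
have ye0 : 0 <= y / eta by rewrite divr_ge0// ltW.
have := expRN_powR_drop beta_gt1 v0 ye0; rewrite -mulrDl -/v.
set ph := expR (- (v `^ beta)); set ph' := expR (- ((_ / eta) `^ _)) => drop.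
set w := (1 + v) `^ (beta - 1) in drop.
have w0 : 0 <= w := powR_ge0 _ _.
have l0 : 0 < X `^ eps := powR_gt0 _ X0.
have ie0 : 0 <= eps^-1 by rewrite invr_ge0 ltW.
(* Truncating at [X ^ eps] with extra exponent [1 / eps] makes the divisor exactly [X]; this
   explains the exponent [m]. *)
have wt : w <= X `^ eps + (1 + v) `^ m / X.
  have := le_truncation w0 l0 ie0.
  by rewrite /w -!powRrM mulfV ?gt_eqF// powRr1// ltW.
(* The decay [expR (- v)] pays for the growth [expR (v / 2)] of the power and leaves
   [expR (- (v / 2))]. *)
have phM : ph * (1 + v) `^ m <= M * expR (- (v / 2)).
  have -> : M * expR (- (v / 2)) =
      expR 1 * expR (- v) * (expR (2^-1 + m * ln (2 * m)) * expR (v / 2)).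
    by rewrite /M -!expRD; congr expR; lra.
  by apply: ler_pM; rewrite ?expR_ge0 ?powR_ge0 ?expRN_powR_le ?powR1D_le_expR.
have ph0 : 0 <= ph by exact: expR_ge0.
have phw : ph * w <= X `^ eps * ph + M / X * expR (- (v / 2)).
  apply: (@le_trans _ _ (ph * (X `^ eps + (1 + v) `^ m / X))); first by rewrite ler_wpM2l.
  rewrite mulrDr [ph * X `^ eps]mulrC lerD2l mulrA [M / X * _]mulrAC ler_pM2r ?invr_gt0//.
have K0 : 0 < Cbeta beta / eta by rewrite divr_gt0.
apply: (@le_trans _ _ (Cbeta beta / eta * (y / eta * beta * (X `^ eps * ph + M / X * expR (- (v / 2)))))).
  rewrite ler_pM2l//; apply: (le_trans drop).
  rewrite [leLHS](_ : _ = y / eta * beta * (ph * w)); last by ring.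
  by rewrite ler_wpM2l// mulr_ge0// ltW.
rewrite le_eqVlt; apply/orP; left; apply/eqP.
have -> : - (2 * eta)^-1 * u = - (v / 2) by rewrite /v; field; rewrite gt_eqF.
by field; rewrite !gt_eqF.
Qed.

End Scaled.
End BetaDensity.

(** * Choice of the scale and assembly of the constants *)

Theorem theorem7 (R : realType) (beta : R) (hbeta : 1 < beta) (eps : R) (heps : 0 < eps) :
  exists C : R, 0 < C /\
  exists eta : nat -> nat -> R, (forall N T : nat, 0 < eta N T) /\
  forall (N T : nat), (0 < N)%N ->
  forall g : 'I_T -> 'I_N -> R, (forall t i, -1 <= g t i <= 0) ->
    gbpa_regret_beta beta (eta N T) g <= C * ((T * N)%:R `^ (2^-1 + eps)).
Proof.
(* [th <= 1] is required by the tail bound, and [th <= eps] gives [N ^ th <= (T * N) ^ eps]. *)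
pose th := Num.min eps 1.
have th0 : 0 < th by rewrite lt_min heps ltr01.
have th1 : th <= 1 by rewrite ge_min lexx orbT.
have the : th <= eps by rewrite ge_min lexx.
pose c := Cbeta beta * expR 1.
have C0 := Cbeta_gt0 hbeta.
have c0 : 0 < c by rewrite mulr_gt0// expR_gt0.
have b0 : 0 < beta by exact: lt_trans hbeta.
pose D := 2 * Cbeta beta * beta * moment_const beta eps.
have D0 : 0 < D.
  by rewrite mulr_gt0 ?mulr_gt0// /moment_const expR_gt0.
pose A0 := (2 * c) `^ th * (2 / th).
have A00 : 0 <= A0 by rewrite mulr_ge0 ?powR_ge0// divr_ge0// ltW.
(* [A0] comes from the potential at the origin, [beta] from the truncated Bregman term, and [1 + D]
   from its remainder. *)
exists (A0 + beta + (1 + D)); split; first lra.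
(* The square root of [T * N] balances the two costs; the value 1 keeps the scale positive when the
   product is 0. *)
exists (fun N T => if (T * N == 0)%N then 1 else (T * N)%:R `^ 2^-1); split.
  by move=> N T; case: ifPn => // TN; rewrite powR_gt0// ltr0n lt0n.
move=> N T N0 g g01; case: T g g01 => [|T] g g01.
  (* With no rounds the bound is 0, and so is every competing sum. *)
  have -> : (0 * N)%:R `^ (2^-1 + eps) = 0 :> R.
    by rewrite mul0n powR0// gt_eqF// addr_gt0.
  rewrite mulr0 /gbpa_regret_beta /expected_regret; apply: sumr_le0 => s _.
  rewrite /traj_prob big_ord0 mul1r; apply: maxlist_le => [|x /mapP[j _ ->]].
    by rewrite -size_eq0 size_map size_enum_ord -lt0n.
  by rewrite big_ord0.
rewrite ifF; last by apply/negbTE; rewrite -lt0n muln_gt0.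
set X : R := (T.+1 * N)%:R.
have X1 : 1 <= X by rewrite ler1n muln_gt0.
have X0 : 0 < X by exact: lt_le_trans X1.
set eta := X `^ 2^-1.
have eta1 : 1 <= eta by rewrite -[leLHS](powRr0 X) ler_powR.
have eta0 : 0 < eta by exact: lt_le_trans eta1.
have etaX : eta * eta = X.
  rewrite /eta -powRD; last by rewrite (gt_eqF X0) implybT.
  have -> : 2^-1 + 2^-1 = 1 :> R by lra.
  by rewrite powRr1// ltW.
set L := X `^ eps.
have L1 : 1 <= L by rewrite -[leLHS](powRr0 X) ler_powR// ltW.
have -> : X `^ (2^-1 + eps) = eta * L.
  by rewrite powRD//; rewrite (gt_eqF X0) implybT.
have NX : N%:R `^ th <= L.
  apply: (@le_trans _ _ (X `^ th)); last by rewrite ler_powR.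
  apply: ge0_ler_powR; rewrite ?nnegrE ?ler0n ?(ltW X0)// ?(ltW th0)//.
  by rewrite ler_nat leq_pmull.
have th2 : 0 < th / (2 * eta) by rewrite divr_gt0// mulr_gt0.
have r2 : 0 < (2 * eta)^-1 by rewrite invr_gt0 mulr_gt0.
pose k := (2 * c * N%:R) `^ th * (2 * eta / th).
have k0 : 0 <= k by rewrite mulr_ge0 ?powR_ge0// divr_ge0 ?mulr_ge0// ltW.
pose q x := k * exponential_pdf (th / (2 * eta)) x.
pose r x := D / (X * eta) * exponential_pdf (2 * eta)^-1 x.
have DX0 : 0 < D / (X * eta) by rewrite divr_gt0// mulr_gt0.
(* With [eta * eta = X] and [eta >= 1], this threshold satisfies [D / (X * eta) <= s ^+ 2], while
   [X * s] is only [(1 + D) * eta]. *)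
pose s := (1 + D) / eta.
have s0 : 0 < s by rewrite divr_gt0//; lra.
have qE : Rintegral lebesgue_measure setT q = k.
  by rewrite RintegralZl ?Rintegral_exponential_pdf ?mulr1//; exact: integrable_exponential_pdf.
have rE : Rintegral lebesgue_measure setT r = D / (X * eta).
  by rewrite RintegralZl ?Rintegral_exponential_pdf ?mulr1//; exact: integrable_exponential_pdf.
rewrite /gbpa_regret_beta.
apply: (@le_trans _ _ (k + T.+1%:R * (N%:R * (beta * L / eta + s)))).
  rewrite -qE; apply: (@smoothed_grad_regret_le R _ _ _ _ N _ _ _ q _ _ _ _ _ r) => //.
  - exact: measurable_scaled_fbeta.
  - exact: scaled_fbeta_ge0.
  - exact: integral_scaled_fbeta.
  - by move=> x y; exact: scaled_fbeta_nonincr.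
  - by move=> x; exact: scaled_fbeta_gt0.
  - by move=> x; exact: scaled_fbeta_neg.
  - by apply: integrableZT; exact: integrable_exponential_pdf.
  - by move=> x; rewrite mulr_ge0// exponential_pdf_ge0// ltW.
  - by move=> x x0; apply: cdf_scaled_fbeta_powN_tail => //; rewrite th0.
  - by rewrite divr_ge0 ?mulr_ge0// ltW// (lt_le_trans ltr01).
  - by apply: measurable_funM => //; exact: measurable_exponential_pdf.
  - by move=> x; rewrite mulr_ge0 ?exponential_pdf_ge0// ltW.
  - by apply: integrableZT; exact: integrable_exponential_pdf.
  - rewrite rE /s expr_div_n expr2 [eta ^+ 2]expr2 etaX.
    rewrite ler_pdivrMr ?mulr_gt0// mulrA divfK ?gt_eqF//.
    apply: (@le_trans _ _ ((1 + D) * (1 + D))); first nra.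
    by rewrite ler_peMr// mulr_ge0; lra.
  - by move=> u y u0 y0; apply: scaled_fbeta_drop.
(* The number of rounds times arms is [X = eta * eta], and one [eta] cancels. *)
have -> : T.+1%:R * (N%:R * (beta * L / eta + s)) = eta * (beta * L + (1 + D)).
  rewrite mulrA -natrM -/X -etaX /s; field; rewrite gt_eqF//.
have -> : k = A0 * N%:R `^ th * eta.
  rewrite /k powRM//; last by rewrite mulr_ge0// ltW.
  rewrite /A0; field; rewrite gt_eqF//.
have : A0 * N%:R `^ th * eta <= A0 * L * eta.
  by rewrite ler_pM2r// ler_wpM2l.
have : (1 + D) * eta <= (1 + D) * eta * L.
  by rewrite ler_peMr// mulr_ge0; lra.
lra.
Qed.
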